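(* Let $s,t\ge0$, $a,b\ge1$ be integers, let $B$ be the solution of $B(n)=B(n-s-B(n-a))+B(n-t-B(n-b))$ with initial values $\xi_1,\dots,\xi_c$, and suppose $B$ is slowly growing. Let $m$ be a positive integer and let $\alpha_1,\dots,\alpha_m$ and $\beta_1,\dots,\beta_m$ be integers with $i-m\le\alpha_i<i$ and $i-m\le\beta_i<i$ for all $1\le i\le m$. If the sequence $C$ defined by $$C(n)=C\Big(n-ms-\sum_{i=1}^m C(n-ma+\alpha_i)\Big)+C\Big(n-mt-\sum_{i=1}^m C(n-mb+\beta_i)\Big)\qquad(n>mc),$$ with initial conditions $\xi_1,\dots,\xi_1,\dots,\xi_c,\dots,\xi_c$ (each $\xi_i$ repeated $m$ times), is well defined, then $C$ is the $m$-interleaving of $B$.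
   Context: A sequence is slowly growing if its successive differences are all $0$ or $1$ and it tends to infinity. The $m$-interleaving of a sequence $b_1,b_2,\dots$ is the sequence in which each term is repeated $m$ times consecutively, i.e. the sequence $A$ with $A(mn-j)=b_n$ for $0\le j<m$. *)

(* Defs.v *)
From mathcomp Require Import all_boot all_order all_algebra.
Set Implicit Arguments.
Unset Strict Implicit.
Unset Printing Implicit Defensive.
Import Order.TTheory GRing.Theory Num.Theory.
Local Open Scope ring_scope.

(* A sequence A(1), A(2), ... of integers is represented by A : int -> int, *)
(* of which only the values at positive indices are meaningful.             *)

Definition slowly_growing (A : int -> int) : Prop :=
  (forall n : int, 1 <= n -> A (n + 1) - A n = 0 \/ A (n + 1) - A n = 1) /\
  (forall M : int, exists N : int, forall n : int, N <= n -> M <= A n).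

Definition interleaving_of (m : nat) (B A : int -> int) : Prop :=
  forall n j : int, 1 <= n -> 0 <= j < m%:Z -> A (m%:Z * n - j) = B n.

(* A is the well-defined sequence with initial values xi and                *)
(*   A(n) = A(n - s - \sum_i A(n - p_i)) + A(n - t - \sum_i A(n - q_i))     *)
(* for n > size xi.  Well-definedness means that every term of A on the     *)
(* right-hand side, inner or outer, is an earlier term of the sequence,     *)
(* i.e. has its index in [1, n - 1]; A is then determined at every positive *)
(* index.                                                                   *)
Definition nested_solution (k : nat) (s t : int) (p q : 'I_k -> int)
    (xi : seq int) (A : int -> int) : Prop :=
  (forall i : nat, (i < size xi)%N -> A i.+1%:Z = xi`_i) /\
  (forall n : int, (size xi)%:Z < n ->
     let x := n - s - \sum_(i < k) A (n - p i) in
     let y := n - t - \sum_(i < k) A (n - q i) in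
     [/\ forall i : 'I_k, 1 <= n - p i < n,
         forall i : 'I_k, 1 <= n - q i < n,
         1 <= x < n,
         1 <= y < n
       & A n = A x + A y]).

(* Main.v *)
Require Import Defs.
From mathcomp Require Import all_boot all_order all_algebra.
From mathcomp Require Import zify.
Import Order.TTheory GRing.Theory Num.Theory.
Local Open Scope ring_scope.

(** Write an index of [C] as [m n - j] with [0 <= j < m] and induct on it.
    With 0-based [i], the [i]-th inner term is [B (n - a) + e_i], where
    [e_i] is [0] or [-1] for [i < j], [0] for [i = j], and [0] or [1] for
    [i > j].  Hence the inner sum is [m B (n - a) + e] with
    [- j <= e <= m - 1 - j], so the outer index [m (n - s - B (n - a)) - (j + e)]
    stays in block number [n - s - B (n - a)]. *)

Lemma nth_flatten_nseq (T : Type) (x0 : T) (m : nat) (s : seq T) (q r : nat) :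
  (r < m)%N ->
  nth x0 (flatten [seq nseq m x | x <- s]) (q * m + r) = nth x0 s q.
Proof.
move=> rm; elim: s q => [|x s IHs] [|q] /=; rewrite ?nth_nil // nth_cat size_nseq.
  by rewrite mul0n add0n rm nth_nseq rm.
by rewrite mulSn -addnA ltnNge leq_addr /= addKn IHs.
Qed.

Lemma size_flatten_nseq (T : Type) (m : nat) (s : seq T) :
  size (flatten [seq nseq m x | x <- s]) = (size s * m)%N.
Proof. by elim: s => //= x s IHs; rewrite size_cat size_nseq IHs mulSn. Qed.

Lemma sum_ord_lt (R : pzSemiRingType) (m j : nat) :
  \sum_(i < m) ((i < j)%N)%:R = (minn m j)%:R :> R.
Proof.
rewrite -natr_sum; congr _%:R; elim: m => [|m IHm]; first by rewrite big_ord0 min0n.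
by rewrite big_ord_recr /= IHm; lia.
Qed.

(** The conclusion says that [j + e] is again an offset inside a block. [CB] is the induction
    hypothesis, and the last hypothesis, from the well-definedness of [C], makes it applicable to
    every inner term. *)
Lemma interleaved_inner_sum {B C : int -> int} {m : nat} {alpha : 'I_m -> int}
    {j : nat} {a n : int} :
  slowly_growing B -> (j < m)%N -> 1 <= n - a ->
  (forall i : 'I_m, i.+1%:Z - m%:Z <= alpha i < i.+1%:Z) ->
  (forall n' l : int, 1 <= n' -> 0 <= l < m%:Z ->
     m%:Z * n' - l < m%:Z * n - j%:Z -> C (m%:Z * n' - l) = B n') ->
  (forall i : 'I_m,
     1 <= m%:Z * n - j%:Z - (m%:Z * a - alpha i) < m%:Z * n - j%:Z) ->
  0 <= j%:Z + (\sum_(i < m) C (m%:Z * n - j%:Z - (m%:Z * a - alpha i))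
               - m%:Z * B (n - a)) < m%:Z.
Proof.
move=> [Bstep _] jm p1 alphaP CB idx; set p := n - a in p1 *.
have e_bounds (i : 'I_m) :
    B p - ((i < j)%N)%:R <= C (m%:Z * n - j%:Z - (m%:Z * a - alpha i))
      <= B p + (1 - ((i < j.+1)%N)%:R).
  have := alphaP i; have := idx i; move: (alpha i) => u idxi uP.
  have im := ltn_ord i.
  (* The inner index is [m p - (j - u)], so it lies in block [p + 1], [p] or [p - 1]. As
     [i - m < u <= i], the first case forces [i > j] and the last [i < j]. *)
  have [u_hi|u_lo] := ltP 0 (u - j%:Z).
    have -> : m%:Z * n - j%:Z - (m%:Z * a - u)
        = m%:Z * (p + 1) - (m%:Z - (u - j%:Z)) by rewrite /p; lia.
    rewrite CB; [|lia..].
    by case: (Bstep p p1); lia.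
  have [u_mid|u_low] := ltP (- m%:Z) (u - j%:Z).
    have -> : m%:Z * n - j%:Z - (m%:Z * a - u)
        = m%:Z * p - (j%:Z - u) by rewrite /p; lia.
    by rewrite CB; lia.
  (* Here [j - u >= m], so positivity of the inner index leaves room for block [p - 1]. *)
  have p2 : 1 <= p - 1 by nia.
  have -> : m%:Z * n - j%:Z - (m%:Z * a - u)
      = m%:Z * (p - 1) - (j%:Z - u - m%:Z) by rewrite /p; lia.
  rewrite CB; [|lia..].
  by case: (Bstep (p - 1) p2); rewrite subrK; lia.
have lo : \sum_(i < m) (B p - ((i < j)%N)%:R)
    <= \sum_(i < m) C (m%:Z * n - j%:Z - (m%:Z * a - alpha i)).
  by apply: ler_sum => i _; case/andP: (e_bounds i).
have hi : \sum_(i < m) C (m%:Z * n - j%:Z - (m%:Z * a - alpha i))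
    <= \sum_(i < m) (B p + (1 - ((i < j.+1)%N)%:R)).
  by apply: ler_sum => i _; case/andP: (e_bounds i).
(* Since [j < m], the indicators sum to [j] in [lo] and to [j + 1] in [hi]. *)
rewrite sumrB sum_ord_lt sumr_const card_ord -(mulr_natl (B p)) !natz in lo.
rewrite big_split /= sumrB sum_ord_lt !sumr_const card_ord
  -(mulr_natl (B p)) !natz in hi.
move: jm lo hi; set S := \sum_(i < m) _; set Q := _ * B p.
by lia.
Qed.

Theorem theorem4p4 (s t a b : int) (c : nat) (xi : c.-tuple int)
  (B : int -> int) (m : nat) (alpha beta : 'I_m -> int) (C : int -> int)
  (hs : 0 <= s) (ht : 0 <= t) (ha : 1 <= a) (hb : 1 <= b)
  (hB : @nested_solution 1 s t (fun=> a) (fun=> b) xi B)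
  (hBslow : slowly_growing B)
  (hm : (0 < m)%N)
  (halpha : forall i : 'I_m, i.+1%:Z - m%:Z <= alpha i < i.+1%:Z)
  (hbeta : forall i : 'I_m, i.+1%:Z - m%:Z <= beta i < i.+1%:Z)
  (hC : @nested_solution m (m%:Z * s) (m%:Z * t)
          (fun i => m%:Z * a - alpha i) (fun i => m%:Z * b - beta i)
          (flatten [seq nseq m x | x <- xi]) C) :
  interleaving_of m B C.
Proof.
case: hB => Binit Brec; case: hC => Cinit Crec.
rewrite size_tuple in Binit Brec.
rewrite size_flatten_nseq size_tuple in Cinit Crec.
suff CB (k : nat) (n j : int) : 1 <= n -> 0 <= j < m%:Z ->
    m%:Z * n - j < k%:Z -> C (m%:Z * n - j) = B n.
  by move=> n j n1 jm; apply: (CB (absz (m%:Z * n - j)%R).+1) => //; lia.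
elim: k n j => [|k IHk] n j n1 jm; first by nia.
case: j jm => // j jm; rewrite -addn1 PoszD => mnk.
have {}IHk (n' l : int) : 1 <= n' -> 0 <= l < m%:Z ->
    m%:Z * n' - l < m%:Z * n - j%:Z -> C (m%:Z * n' - l) = B n'.
  by move=> ? ? ?; apply: IHk => //; lia.
have [cn|nc] := ltP c%:Z n.
  have mcn : (c * m)%N%:Z < m%:Z * n - j%:Z by nia.
  have /= [Ba Bb Bx By ->] := Brec n cn.
  have /= [Ca Cb Cx Cy ->] := Crec _ mcn.
  rewrite !big_ord1 in Bx By *.
  have na1 : 1 <= n - a by case/andP: (Ba ord0).
  have nb1 : 1 <= n - b by case/andP: (Bb ord0).
  have Sa := interleaved_inner_sum hBslow jm na1 halpha IHk Ca.
  have Sb := interleaved_inner_sum hBslow jm nb1 hbeta IHk Cb.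
  (* One claim for both outer terms: [v] is the inner value of [B] and [S] the inner sum of [C]. The
     recurrence of [B] makes the block number positive; that of [C] makes the index an earlier
     one. *)
  have outer (u v S : int) : 1 <= n - u - v < n ->
      0 <= j%:Z + (S - m%:Z * v) < m%:Z ->
      1 <= m%:Z * n - j%:Z - m%:Z * u - S < m%:Z * n - j%:Z ->
      C (m%:Z * n - j%:Z - m%:Z * u - S) = B (n - u - v).
    move=> uv SP lt_idx.
    have E : m%:Z * n - j%:Z - m%:Z * u - S =
      m%:Z * (n - u - v) - (j%:Z + (S - m%:Z * v)) by lia.
    by rewrite E; apply: IHk; lia.
  by congr (_ + _); apply: outer.
case: n n1 nc mnk IHk => [[//|q]|//] _ qc _ _.
(* With [n = q + 1] an initial block, this is the 0-based position in the flattened list: copy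
   [m - j - 1] of entry [q]. *)
have -> : m%:Z * q.+1%:Z - j%:Z = (q * m + (m - j.+1)).+1%N%:Z by nia.
have lt_idx : (q * m + (m - j.+1) < c * m)%N by nia.
by rewrite Cinit // Binit; [|lia]; apply: nth_flatten_nseq; lia.
Qed.
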